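(* Let $V$ be a vector space over $\mathbb{C}$ (possibly infinite dimensional), and let $A$ be a linear operator on $V$ with $T(A)=0$ for some nonzero polynomial $T\in\mathbb{C}[x]$. Let $\lambda_1,\dots,\lambda_k$ be the distinct roots of $T$, with multiplicities $m_1,\dots,m_k$. Then the following hold. (1) Assume $\lambda_j\ne 0$ for all $1\le j\le k$. Then $A$ is invertible and $A^{-1}=L(A)$, where $L$ is the Lagrange interpolation polynomial of the function $1/x$ with interpolation points $\lambda_1,\dots,\lambda_k$ and multiplicities $m_1,\dots,m_k$. (2) Let $f(x)=P(x)/Q(x)$ be a rational function, with $P,Q\in\mathbb{C}[x]$ and $Q(\lambda_j)\ne0$ for all $1\le j\le k$. Let $L$ be the Lagrange interpolation polynomial of $f$ with interpolation points $\lambda_1,\dots,\lambda_k$ and multiplicities $m_1,\dots,m_k$. Then the operator $P(A)[Q(A)]^{-1}$ is defined (i.e. $Q(A)$ is invertible) and it is equal to $L(A)$. (3) For every entire function $F$ of a complex variable, $F(A)=L(A)$, where $L$ is the Lagrange interpolation polynomial of $F$ with interpolation points $\lambda_1,\dots,\lambda_k$ and multiplicities $m_1,\dots,m_k$.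
   Context: For a function $f$ defined and holomorphic on an open subset of $\mathbb{C}$ containing $\lambda_1,\dots,\lambda_k$, the Lagrange interpolation polynomial of $f$ with interpolation points $\lambda_1,\dots,\lambda_k$ (distinct) and multiplicities $m_1,\dots,m_k$ is the unique polynomial $L\in\mathbb{C}[x]$ of degree less than $m_1+\dots+m_k$ such that $L^{(m)}(\lambda_j)=f^{(m)}(\lambda_j)$ for all $1\le j\le k$ and $0\le m<m_j$, where $g^{(0)}=g$ and $g^{(m)}$ is the $m$-th derivative. For an entire function $F(x)=\sum_{r\ge0}a_rx^r$, $F(A)$ denotes $\sum_{r\ge0}a_rA^r$; since $T(A)=0$ with $T\neq 0$, all powers of $A$ lie in the finite-dimensional complex algebra $\mathbb{C}[A]$ generated by $A$, and the series is taken in its usual finite-dimensional topology. *)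

(* Defs.v *)
From HB Require Import structures.
From mathcomp Require Import all_boot all_order all_algebra.
From mathcomp Require Import complex.
From mathcomp Require Import all_classical all_reals all_analysis.
Set Implicit Arguments.
Unset Strict Implicit.
Unset Printing Implicit Defensive.
Import Order.TTheory GRing.Theory Num.Theory.
Import numFieldNormedType.Exports.

Local Open Scope classical_set_scope.
Local Open Scope ring_scope.

(* The field of complex numbers is R[i] with R : realType.  The regular module
   R[i]^o, convertible to R[i], is the one that carries the normed topology in
   which limits and complex derivatives are taken. *)
Definition nth_derivative (R : realType) (n : nat) (f : R[i] -> R[i]) :
  R[i] -> R[i] := derive1n n (f : R[i]^o -> R[i]^o).

Definition entire (R : realType) (F : R[i] -> R[i]) : Prop :=
  forall z : R[i]^o, derivable (F : R[i]^o -> R[i]^o) z 1.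

Definition power_series_expansion (R : realType)
    (F : R[i] -> R[i]) (a : nat -> R[i]) : Prop :=
  forall z : R[i],
    series (fun r : nat => a r * z ^+ r : R[i]^o) @ \oo --> (F z : R[i]^o).

(* "Degree less than n" is [size L <= n], which for n = 0 forces L = 0. *)
Definition is_lagrange_interpolation (R : realType) (k : nat)
    (lam : 'I_k -> R[i]) (m : 'I_k -> nat) (f : R[i] -> R[i])
    (L : {poly R[i]}) : Prop :=
  (size L <= \sum_(j < k) m j)%N /\
  forall (j : 'I_k) (n : nat), (n < m j)%N ->
    (L^`(n)%R).[lam j] = nth_derivative n f (lam j).

Definition poly_op (R : realType) (V : lmodType R[i])
    (p : {poly R[i]}) (A : V -> V) : V -> V :=
  fun v => \sum_(r < size p) p`_r *: iter r A v.

Definition op_inverse (R : realType) (V : lmodType R[i]) (A B : V -> V) : Prop :=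
  cancel A B /\ cancel B A.

(* Convergence in the usual topology of a finite-dimensional subspace E: the
   one transported from the space of row vectors along a linear isomorphism
   phi onto E (linear automorphisms of the space of row vectors being
   homeomorphisms, the choice of phi is immaterial). *)
Definition fin_dim_cvg (R : realType) (W : lmodType R[i]) (E : set W)
    (s : nat -> W) (l : W) : Prop :=
  exists (d : nat) (phi : {linear 'rV[R[i]^o]_d -> W}),
    [/\ injective phi, range phi = E &
      exists (x : nat -> 'rV[R[i]^o]_d) (y : 'rV[R[i]^o]_d),
        [/\ forall n, phi (x n) = s n, phi y = l & x @ \oo --> y]].

Definition op_algebra (R : realType) (V : lmodType R[i]) (A : V -> V) :
  set (V -> V) := range (fun p : {poly R[i]} => poly_op p A).

(* B is the sum of the series a_0 + a_1 A + a_2 A^2 + ... *)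
Definition op_power_series_sum (R : realType) (V : lmodType R[i])
    (a : nat -> R[i]) (A B : V -> V) : Prop :=
  fin_dim_cvg (op_algebra A)
    (fun (n : nat) (v : V) => \sum_(r < n) a r *: iter r A v) B.

(* Main.v *)
Require Import Defs.
From HB Require Import structures.
From mathcomp Require Import all_boot all_order all_algebra.
From mathcomp Require Import complex.
From mathcomp Require Import all_classical all_reals all_analysis.
From mathcomp Require Import ring.
Import Order.TTheory GRing.Theory Num.Theory.
Import numFieldNormedType.Exports.
Set Implicit Arguments.
Unset Strict Implicit.

Local Open Scope classical_set_scope.
Local Open Scope ring_scope.

(** Since T(A) = 0, the operator p(A) only depends on the class of the
    polynomial p modulo T.  By the Chinese remainder theorem, that class amounts
    to the collection of the jets of p at the roots: T divides G as soon as,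
    for every root lambda_j, the derivatives of G of order less than m_j vanish
    at lambda_j ([dvdp_of_local], [dvdp_exp_XsubC_derivn]).  Any two polynomials
    with the same jets therefore give the same operator, and a polynomial L with
    the jets of a function f is the natural candidate for f(A).

    For f = P/Q, the polynomial Q is coprime to T, and a Bezout relation
    UQ + WT = 1 makes U(A) the inverse of Q(A).  Then P U is a polynomial such
    that (P U) Q - P vanishes to order m_j at lambda_j, so that it has the same
    jets as P/Q there ([derive1n_quotient_of_dvdp]), hence the same jets as L,
    and P(A) U(A) = L(A).  The inverse of A is the case P = 1, Q = X.

    For an entire function F = sum a_r x^r with partial sums S_N, the class of
    S_N modulo T is a fixed linear expression in the jets of S_N at the roots
    ([hermite_basis]).  The power series can be differentiated term by term
    ([power_series_derive]), so these jets converge to those of F, which are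
    those of L.  Hence the remainders of S_N modulo T, and a fortiori modulo the
    minimal polynomial M of A, converge coefficientwise to the remainder of L.
    The remainders modulo M are coordinates on the algebra generated by A, and
    S_N(A) converges to L(A) ([op_power_series_sum_interpolation]). *)

(** * Polynomials and their jets at finitely many points *)

Lemma poly_taylor (K : comNzRingType) (p : {poly K}) (x : K) :
  p = \sum_(i < size p) p^`N(i).[x] *: ('X - x%:P) ^+ i.
Proof.
have E : 'X = x%:P + ('X - x%:P) by rewrite addrC subrK.
(* Taylor's formula for evaluation, applied over the ring of polynomials to
   p(X) = p(x + (X - x)). *)
rewrite -{1}[p]comp_polyXr /comp_poly {1}E nderiv_taylor; last exact: mulrC.
rewrite size_map_polyC; apply: eq_bigr => i _.
by rewrite nderivn_map horner_map /= mul_polyC.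
Qed.

Lemma dvdp_taylor_remainder (K : fieldType) (p : {poly K}) (x : K) (m : nat) :
  ('X - x%:P) ^+ m %| p - \sum_(i < m) p^`N(i).[x] *: ('X - x%:P) ^+ i.
Proof.
pose n := (m + size p)%N.
have E : p = \sum_(i < n) p^`N(i).[x] *: ('X - x%:P) ^+ i.
  rewrite {1}(poly_taylor p x) /n addnC big_split_ord /=.
  rewrite [X in _ = _ + X]big1 ?addr0 // => i _.
  by rewrite nderivn_poly0 ?horner0 ?scale0r // leq_addr.
rewrite {1}E /n big_split_ord /= addrAC subrr add0r.
apply: (big_ind (fun q => _ %| q)).
- exact: dvdp0.
- by move=> p1 p2; exact: dvdp_add.
- by move=> i _; rewrite -mul_polyC dvdp_mull // exprD dvdp_mulr.
Qed.

Lemma dvdp_exp_XsubC_derivn (K : numFieldType) (p : {poly K}) (x : K)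
    (m : nat) :
  (forall i, (i < m)%N -> p^`(i).[x] = 0) -> ('X - x%:P) ^+ m %| p.
Proof.
move=> p0; have := dvdp_taylor_remainder p x m.
rewrite big1 ?subr0 // => i _; have := p0 i (ltn_ord i).
rewrite nderivn_def hornerMn => /eqP; rewrite mulrn_eq0.
by rewrite (gtn_eqF (fact_gt0 i)) => /eqP ->; rewrite scale0r.
Qed.

Lemma dvdp_prod_coprime (K : fieldType) (I : eqType) (s : seq I)
    (P : pred I) (B : I -> {poly K}) (G : {poly K}) :
  uniq s -> {in s &, forall i j, i != j -> coprimep (B i) (B j)} ->
  (forall i, i \in s -> P i -> B i %| G) -> \prod_(i <- s | P i) B i %| G.
Proof.
elim: s => [|i s IH] /=; first by rewrite big_nil dvd1p.
move=> /andP[is_ us] cop dG; rewrite big_cons.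
have IH' : \prod_(j <- s | P j) B j %| G.
  apply: IH => // [j k js ks|j js]; last by apply: dG; rewrite inE js orbT.
  by apply: cop; rewrite inE ?js ?ks orbT.
case: ifP => // Pi; rewrite Gauss_dvdp ?IH' ?andbT ?dG ?mem_head //.
rewrite big_seq_cond; apply: (big_ind (fun q => coprimep (B i) q)).
- exact: coprimep1.
- by move=> p q cp cq; rewrite coprimepMr cp.
- move=> j /andP[js _]; apply: cop; rewrite ?mem_head ?inE ?js ?orbT //.
  by apply: contraNneq is_ => ->.
Qed.

Lemma coprimep_XsubC_pow (K : fieldType) (k : nat) (lam : 'I_k -> K)
    (m : 'I_k -> nat) (i j : 'I_k) :
  injective lam -> i != j ->
  coprimep (('X - (lam i)%:P) ^+ m i) (('X - (lam j)%:P) ^+ m j).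
Proof.
move=> lam_inj ij; rewrite coprimep_expl // coprimep_expr // coprimep_XsubC2 //.
by rewrite subr_eq0; apply: contraNneq ij => /lam_inj ->.
Qed.

Definition roots_with_multiplicities (K : closedFieldType) (T : {poly K})
    (k : nat) (lam : 'I_k -> K) (m : 'I_k -> nat) : Prop :=
  [/\ T != 0, injective lam, forall z, root T z <-> exists j, lam j = z &
    forall j, m j = mup (lam j) T].

(** The product D of the local factors divides T, and the cofactor T / D is
    constant: a root of it would be some lambda_j, with a multiplicity in T
    exceeding m_j. *)
Lemma dvdp_of_local (K : closedFieldType) (T : {poly K}) (k : nat)
    (lam : 'I_k -> K) (m : 'I_k -> nat) (G : {poly K}) :
  roots_with_multiplicities T lam m ->
  (forall j, ('X - (lam j)%:P) ^+ m j %| G) -> T %| G.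
Proof.
move=> [T0 lam_inj rootT mE] dG.
pose D : {poly K} := \prod_j ('X - (lam j)%:P) ^+ m j.
have dvdD (E : {poly K}) : (forall j, ('X - (lam j)%:P) ^+ m j %| E) -> D %| E.
  move=> dE; apply: dvdp_prod_coprime; rewrite ?index_enum_uniq //.
  by move=> i j _ _; exact: coprimep_XsubC_pow.
have /dvdpP[W TW] : D %| T by apply: dvdD => j; rewrite mE -mup_geq.
have : size W == 1%N.
  apply: contraT => /(closed_rootP W)[z Wz].
  have /rootT[j jz] : root T z by rewrite TW rootM Wz.
  have : ((m j).+1 <= mup (lam j) T)%N.
    rewrite mup_geq // exprS TW dvdp_mul //; first by rewrite dvdp_XsubCl jz.
    by rewrite /D (bigD1 j) //= dvdp_mulr.
  by rewrite mE ltnn.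
case/size_poly1P => c c0 Wc; rewrite TW Wc mul_polyC dvdpZl //; exact: dvdD.
Qed.

Lemma crt_idempotents (K : fieldType) (k : nat) (B : 'I_k -> {poly K}) :
  (forall i j, i != j -> coprimep (B i) (B j)) ->
  exists e : 'I_k -> {poly K},
    forall i j, B i %| e j - (i == j)%:R.
Proof.
move=> cop; suff ex j : exists e : {poly K}, forall i, B i %| e - (i == j)%:R.
  by exists (fun j => projT1 (cid (ex j))) => i j; case: cid.
pose C : {poly K} := \prod_(i | i != j) B i.
have cBC : coprimep (B j) C.
  apply: (big_ind (fun q => coprimep (B j) q)) => [|p q cp cq|i ij].
  - exact: coprimep1.
  - by rewrite coprimepMr cp.
  - by rewrite cop // eq_sym.
have [[u v] /= uv] := Bezout_eq1_coprimepP _ _ cBC.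
exists (v * C) => i; case: eqVneq => [->|ij].
  by rewrite -uv opprD addrCA subrr addr0 dvdpNr dvdp_mull.
by rewrite subr0 dvdp_mull // /C (bigD1 i) //= dvdp_mulr.
Qed.

(** The class of a polynomial modulo T is a linear combination of its jets at
    the roots, with coefficients H j n that do not depend on the polynomial: if
    e_j is 1 modulo the j-th local factor of T and 0 modulo the others, take
    e_j (X - lambda_j)^n / n! and compare with the Taylor expansion at each
    root. *)
Lemma hermite_basis (K : numClosedFieldType) (T : {poly K}) (k : nat)
    (lam : 'I_k -> K) (m : 'I_k -> nat) :
  roots_with_multiplicities T lam m ->
  exists H : 'I_k -> nat -> {poly K}, forall p : {poly K},
    T %| p - \sum_(j < k) \sum_(n < m j) p^`(n).[lam j] *: H j n.
Proof.
move=> rT; have [T0 lam_inj _ _] := rT.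
have [e eP] := crt_idempotents
  (fun i j : 'I_k => @coprimep_XsubC_pow _ _ _ m i j lam_inj).
exists (fun j n => n`!%:R^-1 *: ('X - (lam j)%:P) ^+ n * e j) => p.
apply: (dvdp_of_local rT) => i; set B := _ ^+ _.
pose t j : {poly K} :=
  \sum_(n < m j) p^`N(n).[lam j] *: ('X - (lam j)%:P) ^+ n.
have -> : p - \sum_(j < k) \sum_(n < m j) p^`(n).[lam j] *:
    (n`!%:R^-1 *: ('X - (lam j)%:P) ^+ n * e j) =
  (p - t i) - \sum_(j < k) t j * (e j - (i == j)%:R).
  transitivity (p - \sum_(j < k) t j * e j).
    congr (_ - _); apply: eq_bigr => j _; rewrite /t mulr_suml.
    apply: eq_bigr => n _; rewrite -scalerAl scalerA -scalerAl; congr (_ *: _).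
    rewrite nderivn_def hornerMn -mulr_natr mulfK ?pnatr_eq0 //.
    by rewrite -lt0n fact_gt0.
  rewrite -addrA -opprD; congr (_ - _).
  have {1}-> : t i = \sum_(j < k) t j * (i == j)%:R.
    rewrite (bigD1 i) //= eqxx mulr1 big1 ?addr0 // => j ji.
    by rewrite eq_sym (negPf ji) mulr0.
  rewrite -big_split /=; apply: eq_bigr => j _.
  by rewrite -mulrDr addrC subrK.
apply: dvdp_sub; first exact: dvdp_taylor_remainder.
apply: (big_ind (fun q => B %| q)); first exact: dvdp0.
  by move=> p1 p2; exact: dvdp_add.
by move=> j _; apply: dvdp_mull; exact: eP.
Qed.

(** * Polynomials in an operator *)

Lemma poly_op_widen (R : realType) (V : lmodType R[i]) (A : V -> V)
    (p : {poly R[i]}) (n : nat) (v : V) :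
  (size p <= n)%N -> poly_op p A v = \sum_(r < n) p`_r *: iter r A v.
Proof.
move=> pn; rewrite /poly_op (big_ord_widen _ (fun r => p`_r *: iter r A v) pn).
rewrite big_mkcond; apply: eq_bigr => r _; case: ltnP => // pr.
by rewrite nth_default ?scale0r.
Qed.

Lemma poly_op_linearl (R : realType) (V : lmodType R[i]) (A : V -> V)
    (c : R[i]) (p q : {poly R[i]}) (v : V) :
  poly_op (c *: p + q) A v = c *: poly_op p A v + poly_op q A v.
Proof.
pose n := maxn (size (c *: p + q)) (maxn (size p) (size q)).
rewrite !(@poly_op_widen _ _ _ _ n) ?leq_max ?leqnn ?orbT //.
rewrite scaler_sumr -big_split; apply: eq_bigr => r _ /=.
by rewrite coefD coefZ scalerDl scalerA.
Qed.

Lemma poly_opC (R : realType) (V : lmodType R[i]) (A : V -> V) (c : R[i])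
    (v : V) :
  poly_op c%:P A v = c *: v.
Proof.
by rewrite (@poly_op_widen _ _ _ _ 1) ?size_polyC_leq1 // big_ord1 coefC.
Qed.

Lemma poly_op0 (R : realType) (V : lmodType R[i]) (A : V -> V) (v : V) :
  poly_op 0 A v = 0.
Proof. by rewrite -[0 in LHS]/(0%:P) poly_opC scale0r. Qed.

Lemma poly_opZ (R : realType) (V : lmodType R[i]) (A : V -> V) (c : R[i])
    (p : {poly R[i]}) (v : V) :
  poly_op (c *: p) A v = c *: poly_op p A v.
Proof. by rewrite -[_ *: p]addr0 poly_op_linearl poly_op0 addr0. Qed.

Lemma poly_opD (R : realType) (V : lmodType R[i]) (A : V -> V)
    (p q : {poly R[i]}) (v : V) :
  poly_op (p + q) A v = poly_op p A v + poly_op q A v.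
Proof. by rewrite -[p in LHS]scale1r poly_op_linearl scale1r. Qed.

Lemma poly_opMX (R : realType) (V : lmodType R[i]) (A : V -> V)
    (p : {poly R[i]}) (v : V) :
  poly_op (p * 'X) A v = poly_op p A (A v).
Proof.
rewrite (@poly_op_widen _ _ _ _ (size p).+1); last first.
  by rewrite (leq_trans (size_polyMleq _ _)) // size_polyX addn2.
rewrite big_ord_recl coefMX scale0r add0r; apply: eq_bigr => r _.
by rewrite coefMX /= -iterSr.
Qed.

Lemma iter_is_linear (R : realType) (V : lmodType R[i]) (A : {linear V -> V})
    (r : nat) :
  linear (iter r A).
Proof. by elim: r => [|r IH] c u v //=; rewrite IH linearP. Qed.

Lemma poly_op_is_linear (R : realType) (V : lmodType R[i])
    (A : {linear V -> V}) (p : {poly R[i]}) :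
  linear (poly_op p A).
Proof.
move=> c u v; rewrite /poly_op scaler_sumr -big_split; apply: eq_bigr => r _ /=.
by rewrite iter_is_linear scalerDr !scalerA mulrC.
Qed.

HB.instance Definition _ (R : realType) (V : lmodType R[i])
    (A : {linear V -> V}) (p : {poly R[i]}) :=
  GRing.isLinear.Build R[i] V V _ (poly_op p A) (poly_op_is_linear A p).

Lemma poly_opM (R : realType) (V : lmodType R[i]) (A : {linear V -> V})
    (p q : {poly R[i]}) (v : V) :
  poly_op (p * q) A v = poly_op p A (poly_op q A v).
Proof.
elim/poly_ind: q v => [|q c IH] v; first by rewrite mulr0 !poly_op0 linear0.
rewrite mulrDr mulrA !poly_opD !poly_opMX IH [p * _]mulrC mul_polyC poly_opZ.
by rewrite poly_opC linearD linearZ.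
Qed.

Lemma poly_op_congr (R : realType) (V : lmodType R[i]) (A : {linear V -> V})
    (T p q : {poly R[i]}) :
  (forall v, poly_op T A v = 0) -> T %| p - q -> poly_op p A =1 poly_op q A.
Proof.
move=> TA /dvdpP[u pq] v.
by rewrite -[p](subrK q) pq poly_opD poly_opM TA linear0 add0r.
Qed.

(** The powers of A of exponent less than the degree of M form a basis of the
    algebra generated by A, which those of exponent less than the degree of an
    arbitrary annihilating polynomial need not do. *)
Lemma minimal_polynomial (R : realType) (V : lmodType R[i])
    (A : {linear V -> V}) (T : {poly R[i]}) :
  T != 0 -> (forall v, poly_op T A v = 0) ->
  exists M : {poly R[i]}, [/\ M != 0, forall v, poly_op M A v = 0 &
    forall p, (forall v, poly_op p A v = 0) -> M %| p].
Proof.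
move=> T0 TA.
pose P n := `[< exists p : {poly R[i]},
  [/\ p != 0, size p = n & forall v, poly_op p A v = 0] >].
have exP : exists n, P n by exists (size T); apply/asboolP; exists T.
have [n /asboolP[M [M0 Mn MA]] nmin] := ex_minnP exP.
exists M; split=> // p pA; apply/modp_eq0P/eqP; apply: contraT => r0.
have : P (size (p %% M)).
  apply/asboolP; exists (p %% M); split=> // v; move: (pA v).
  by rewrite {1}(divp_eq p M) poly_opD poly_opM MA linear0 add0r.
by move/nmin; rewrite -Mn leqNgt ltn_modp M0.
Qed.

Lemma op_inverse_poly_op (R : realType) (V : lmodType R[i])
    (A : {linear V -> V}) (T Q U : {poly R[i]}) :
  (forall v, poly_op T A v = 0) -> T %| U * Q - 1 ->
  op_inverse (poly_op Q A) (poly_op U A).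
Proof.
move=> TA UQ; have one v : poly_op (U * Q) A v = v.
  by rewrite (poly_op_congr TA UQ) poly_opC scale1r.
by split=> v; rewrite -poly_opM // [Q * U]mulrC.
Qed.

(** * Derivatives of rational functions *)

Lemma is_derive_horner (K : numFieldType) (p : {poly K}) (x : K^o) :
  is_derive x 1 (horner p : K^o -> K^o) p^`().[x].
Proof.
elim/poly_ind: p => [|p c IH].
  rewrite deriv0 horner0.
  have -> : horner 0 = cst 0 :> (K^o -> K^o).
    by apply/funext => y; rewrite horner0.
  exact: is_derive_cst.
have -> : horner (p * 'X + c%:P) =
    (horner p : K^o -> K^o) * id + cst c :> (K^o -> K^o).
  by apply/funext => y; rewrite hornerMXaddC.
rewrite derivD derivM derivX derivC addr0 hornerD mulr1 hornerM hornerX.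
apply: is_derive_eq.
by rewrite addr0 scaler1 addrC /GRing.scale/= mulrC.
Qed.

Lemma near_horner_neq0 (K : numFieldType) (Q : {poly K}) (x : K^o) :
  Q.[x] != 0 -> \forall y \near x, Q.[y] != 0.
Proof.
move=> Qx; have dQ := is_derive_horner Q x.
have cQ : {for x, continuous (horner Q : K^o -> K^o)}.
  by apply/differentiable_continuous/derivable1_diffP; exact: ex_derive.
exact: (cvgr_neq0 _ cQ Qx).
Qed.

Lemma is_derive_horner_div (K : numFieldType) (P Q : {poly K}) (x : K^o) :
  Q.[x] != 0 ->
  is_derive x 1 (fun y : K^o => P.[y] / Q.[y] : K^o)
    ((P^`() * Q - P * Q^`()).[x] / Q.[x] ^+ 2).
Proof.
move=> Qx; have dP := is_derive_horner P x; have dQ := is_derive_horner Q x.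
have dV : is_derive x 1 (fun y : K^o => Q.[y]^-1 : K^o)
    (- Q.[x] ^- 2 *: (Q^`()).[x]).
  apply: DeriveDef; first by apply: derivableV => //; exact: ex_derive.
  by rewrite deriveV ?derive_val //; exact: ex_derive.
have := is_deriveM dP dV; congr is_derive.
by rewrite hornerD hornerN !hornerM /GRing.scale/=; field; exact: Qx.
Qed.

(** The n-th derivative of P / Q is [quotient_derivn_num Q P n] / Q^(n+1).  The
    fraction is not reduced, which makes the numerator additive in P. *)
Fixpoint quotient_derivn_num (K : comNzRingType) (Q P : {poly K}) (n : nat) :
    {poly K} :=
  if n is n'.+1 then
    (quotient_derivn_num Q P n')^`() * Q
      - (quotient_derivn_num Q P n' * Q^`()) *+ n
  else P.

Lemma derive1n_horner_div (K : numFieldType) (P Q : {poly K}) (n : nat)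
    (x : K) :
  Q.[x] != 0 ->
  derive1n n (fun y : K^o => P.[y] / Q.[y] : K^o) x =
    (quotient_derivn_num Q P n).[x] / Q.[x] ^+ n.+1.
Proof.
elim: n x => [|n IH] x Qx; first by rewrite derive1n0 expr1.
rewrite derive1nS derive1E; set N := quotient_derivn_num Q P n in IH *.
rewrite (@near_eq_derive _ _ _ _
  (fun y : K^o => N.[y] / (Q ^+ n.+1).[y] : K^o)); last first.
  by near=> y; rewrite IH ?horner_exp //; near: y; exact: near_horner_neq0.
have Qx' : (Q ^+ n.+1).[x] != 0 by rewrite horner_exp expf_neq0.
have dN := is_derive_horner_div N Qx'; rewrite derive_val /= -/N.
rewrite deriv_exp !(hornerE, hornerMn) /= -[_ *+ n.+1]mulr_natr.
rewrite -[(_ * _) *+ n.+1]mulr_natr !exprS.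
have Qn : Q.[x] ^+ n != 0 by rewrite expf_neq0.
move: (Q.[x] ^+ n) Qn => c c0; field; by rewrite ?c0 ?Qx.
Unshelve. all: by end_near. Qed.

Lemma quotient_derivn_numB (K : comNzRingType) (Q P1 P2 : {poly K}) (n : nat) :
  quotient_derivn_num Q (P1 - P2) n =
    quotient_derivn_num Q P1 n - quotient_derivn_num Q P2 n.
Proof. by elim: n => //= n ->; rewrite derivB; ring. Qed.

Lemma quotient_derivn_num_mulr (K : comNzRingType) (Q L : {poly K}) (n : nat) :
  quotient_derivn_num Q (L * Q) n = L^`(n) * Q ^+ n.+1.
Proof.
elim: n => [|n IH]; first by rewrite expr1.
by rewrite derivnS [LHS]/= IH derivM deriv_exp succnK !exprS; ring.
Qed.

Lemma dvdp_quotient_derivn_num (K : fieldType) (Q G : {poly K}) (x : K)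
    (m n : nat) :
  ('X - x%:P) ^+ (n + m) %| G ->
  ('X - x%:P) ^+ m %| quotient_derivn_num Q G n.
Proof.
elim: n m => [|n IH] m //; rewrite addSnnS => /IH /dvdpP[W] /= ->.
rewrite derivM deriv_exp derivXsubC mul1r /= exprS.
apply/dvdpP; exists ((W^`() * ('X - x%:P) + W *+ m.+1) * Q
  - (W * ('X - x%:P) * Q^`()) *+ n.+1).
by ring.
Qed.

(** Congruence of L Q and P modulo (X - x)^m amounts to L and P / Q having the
    same Taylor expansion at x up to order m: the difference is (L Q - P) / Q,
    and each differentiation costs at most one factor X - x of the numerator. *)
Lemma derive1n_quotient_of_dvdp (K : numFieldType) (P Q L : {poly K}) (x : K)
    (m n : nat) :
  Q.[x] != 0 -> ('X - x%:P) ^+ m %| L * Q - P -> (n < m)%N ->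
  derive1n n (fun y : K^o => P.[y] / Q.[y] : K^o) x = L^`(n).[x].
Proof.
move=> Qx dG nm; rewrite derive1n_horner_div //.
have : ('X - x%:P) ^+ 1 %| quotient_derivn_num Q (L * Q - P) n.
  apply: dvdp_quotient_derivn_num; rewrite (dvdp_trans _ dG) //.
  by rewrite dvdp_exp2l ?addn1.
rewrite expr1 dvdp_XsubCl quotient_derivn_numB quotient_derivn_num_mulr.
rewrite rootE hornerD hornerN hornerM horner_exp subr_eq0 => /eqP <-.
by rewrite mulfK // expf_neq0.
Qed.

Lemma rational_functional_calculus (R : realType) (V : lmodType R[i])
    (A : {linear V -> V}) (T : {poly R[i]}) (k : nat) (lam : 'I_k -> R[i])
    (m : 'I_k -> nat) (P Q : {poly R[i]}) :
  (forall v, poly_op T A v = 0) -> roots_with_multiplicities T lam m ->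
  (forall j, Q.[lam j] != 0) ->
  exists QA' : {linear V -> V},
    op_inverse (poly_op Q A) QA' /\
    forall L : {poly R[i]},
      is_lagrange_interpolation lam m (fun x => P.[x] / Q.[x]) L ->
      poly_op P A \o QA' =1 poly_op L A.
Proof.
move=> TA rT Q0; have [T0 _ rootT mE] := rT.
have /Bezout_eq1_coprimepP[[U W] /= UW] : coprimep Q T.
  rewrite coprimep_sym; apply/Pdiv.ClosedField.coprimepP => z /rootT[j <-].
  exact: Q0.
have UQ : T %| U * Q - 1.
  by rewrite -UW opprD addrA subrr add0r dvdpNr dvdp_mull.
exists (poly_op U A); split; first exact: op_inverse_poly_op UQ.
move=> L [_ LP] v; rewrite /= -poly_opM.
apply/esym/(poly_op_congr TA)/(dvdp_of_local rT) => j.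
apply: dvdp_exp_XsubC_derivn => n nm.
have PUQ : ('X - (lam j)%:P) ^+ m j %| P * U * Q - P.
  have -> : P * U * Q - P = P * (U * Q - 1) by ring.
  by apply: dvdp_mull; apply: dvdp_trans UQ; rewrite -mup_geq // mE.
rewrite derivnB hornerD hornerN LP // /nth_derivative.
by rewrite (derive1n_quotient_of_dvdp (Q0 j) PUQ nm) subrr.
Qed.

(** * Everywhere convergent complex power series *)

Lemma normc_i (R : rcfType) : `|'i%C : R[i]| = 1.
Proof. by rewrite normc_def /= expr0n expr1n add0r sqrtr1. Qed.

Lemma cvg_complex (R : realType) (s : nat -> R[i]) (x y : R) :
  (fun n => complex.Re (s n)) @ \oo --> x ->
  (fun n => complex.Im (s n)) @ \oo --> y ->
  (s : nat -> R[i]^o) @ \oo --> (x +i* y : R[i]^o)%C.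
Proof.
move=> sx sy; apply/cvgrPdist_lt => e e0.
(* A positive element of R[i] is real. *)
have [er e0'] : (complex.Re e)%:C%C = e /\ 0 < complex.Re e.
  by move: e e0 => [a b]; rewrite ltcE /= => /andP[/eqP -> ?].
have e2 : 0 < complex.Re e / 2 by rewrite divr_gt0.
move/cvgrPdist_lt : sx => /(_ _ e2) sx; move/cvgrPdist_lt : sy => /(_ _ e2) sy.
near=> n; have nx : `|x - complex.Re (s n)| < complex.Re e / 2 by near: n.
have ny : `|y - complex.Im (s n)| < complex.Re e / 2 by near: n.
rewrite -er [complex.Re e]splitr.
have -> : (x +i* y)%C - s n =
    (x - complex.Re (s n))%:C%C + 'i%C * (y - complex.Im (s n))%:C%C.
  by case: (s n) => a b; rewrite [LHS]complexE.
apply: le_lt_trans (ler_normD _ _) _; rewrite normrM.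
have nC (a : R) : `|a%:C%C| = (`|a|)%:C%C.
  by rewrite normc_def /= expr0n addr0 sqrtr_sqr.
by rewrite normc_i mul1r !nC -raddfD /= ltcR ltrD.
Unshelve. all: by end_near. Qed.

(** The real and imaginary parts converge by comparison with a real geometric
    series; the sums of these two real series give the limit. *)
Lemma cvg_series_geometric_dominated (R : realType) (u : nat -> R[i])
    (c : R[i]) :
  (forall n, `|u n| <= c * 2^-1 ^+ n) ->
  exists l : R[i]^o, series (u : nat -> R[i]^o) @ \oo --> l.
Proof.
move=> uc.
have c0 : 0 <= c by have := uc 0%N; rewrite expr0 mulr1; apply: le_trans.
have cE : (complex.Re c)%:C%C = c by rewrite RRe_real // ger0_real.
have cv (v : nat -> R) :
    (forall n, (`|v n|)%:C%C <= `|u n|) -> cvgn (series v).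
  move=> vu; apply: (@normed_cvg _ R^o).
  apply: (@series_le_cvg _ _ (geometric (complex.Re c) 2^-1)).
  - by move=> n; exact: normr_ge0.
  - by move=> n /=; rewrite mulr_ge0 ?exprn_ge0 ?invr_ge0 // -ler0c cE.
  - move=> n /=; rewrite -lecR (le_trans (vu n)) // (le_trans (uc n)) //.
    by rewrite rmorphM rmorphXn fmorphV /= rmorph_nat cE.
  - apply: is_cvg_geometric_series.
    by rewrite ger0_norm ?invr_ge0 // invf_lt1 ?ltr1n.
have cRe : cvgn (series (fun n => complex.Re (u n))).
  by apply: cv => n; exact: normc_ge_Re.
have cIm : cvgn (series (fun n => complex.Im (u n))).
  apply: cv => n; apply: le_trans (_ : `|u n * 'i%C| <= _).
    by apply: le_trans (normc_ge_Re _); rewrite ReiNIm normrN.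
  by rewrite normrM normc_i mulr1.
exists (limn (series (fun n => complex.Re (u n))) +i*
        limn (series (fun n => complex.Im (u n))))%C.
apply: cvg_complex.
  suff -> : (fun n => complex.Re (series u n)) =
      series (fun n => complex.Re (u n)) by [].
  by apply/funext => n; rewrite !seriesEnat /= raddf_sum.
suff -> : (fun n => complex.Im (series u n)) =
    series (fun n => complex.Im (u n)) by [].
by apply/funext => n; rewrite !seriesEnat /= raddf_sum.
Qed.

Lemma cvg_norm_le (K : numFieldType) (u : nat -> K^o) (l : K^o) (b : K) :
  u @ \oo --> l -> (forall n, `|u n| <= b) -> `|l| <= b.
Proof.
move=> ul ub; have b0 : 0 <= b by apply: le_trans (ub 0%N).
rewrite real_leNgt ?ger0_real //; apply/negP => bl.
have e0 : 0 < `|l| - b by rewrite subr_gt0.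
move/cvgrPdist_lt : ul => /(_ _ e0) [N _ /(_ N (leqnn N))] /=.
rewrite ltrBrDr => lt_l; suff : `|l| < `|l| by rewrite ltxx.
apply: le_lt_trans lt_l; rewrite -[X in `|X| <= _](subrK (u N)).
by rewrite (le_trans (ler_normD _ _)) // lerD.
Qed.

Lemma ler_norm_exprD (K : numDomainType) (z h : K) (r : nat) :
  `|h| <= 1 -> `|(z + h) ^+ r - z ^+ r| <= `|h| * (1 + `|z|) ^+ r.
Proof.
move=> h1; elim: r => [|r IH].
  by rewrite subrr normr0 mulr_ge0 // exprn_ge0.
have -> : (z + h) ^+ r.+1 - z ^+ r.+1 =
    z * ((z + h) ^+ r - z ^+ r) + h * (z + h) ^+ r by rewrite !exprS; ring.
apply: le_trans (ler_normD _ _) _; rewrite !normrM.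
have -> : `|h| * (1 + `|z|) ^+ r.+1 =
  `|z| * (`|h| * (1 + `|z|) ^+ r) + `|h| * (1 + `|z|) ^+ r.
  by rewrite exprS; ring.
rewrite lerD ?ler_wpM2l // normrX lerXn2r ?nnegrE ?addr_ge0 //.
by rewrite (le_trans (ler_normD _ _)) // addrC lerD.
Qed.

(** The quadratic error of the tangent to z^r, in a form where the dependence
    on r is geometric so that it can be summed against the coefficients. *)
Lemma ler_norm_exprD_tangent (K : numDomainType) (z h : K) (r : nat) :
  `|h| <= 1 ->
  `|(z + h) ^+ r - z ^+ r - (z ^+ r.-1 *+ r) * h|
    <= `|h| ^+ 2 * (1 + `|z|) ^+ r.
Proof.
move=> h1; elim: r => [|r IH].
  by rewrite mulr0n mul0r subr0 subrr normr0 mulr_ge0 // exprn_ge0.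
have -> : (z + h) ^+ r.+1 - z ^+ r.+1 - (z ^+ r.+1.-1 *+ r.+1) * h =
    z * ((z + h) ^+ r - z ^+ r - (z ^+ r.-1 *+ r) * h)
    + h * ((z + h) ^+ r - z ^+ r).
  rewrite succnK; case: r {IH} => [|r]; first by rewrite !expr0 !expr1; ring.
  by rewrite succnK !exprS; move: ((z + h) ^+ r) (z ^+ r) => a b; ring.
apply: le_trans (ler_normD _ _) _; rewrite !normrM.
have -> : `|h| ^+ 2 * (1 + `|z|) ^+ r.+1 =
  `|z| * (`|h| ^+ 2 * (1 + `|z|) ^+ r) + `|h| * (`|h| * (1 + `|z|) ^+ r).
  by rewrite [_ ^+ r.+1]exprS; ring.
by rewrite lerD ?ler_wpM2l ?ler_norm_exprD.
Qed.

Lemma power_series_coef_bound (R : realType) (F : R[i] -> R[i])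
    (a : nat -> R[i]) (rho : R[i]) :
  power_series_expansion F a -> 0 <= rho ->
  exists C, forall r, `|a r| * rho ^+ r <= C.
Proof.
move=> /(_ rho) Fa rho0.
have /cvgrPdist_lt/(_ 1 ltr01) [N _ NP] := cvg_series_cvg_0 (cvgP _ Fa).
exists (1 + \sum_(k < N) `|a k| * rho ^+ k) => r.
have pos k : 0 <= `|a k| * rho ^+ k by rewrite mulr_ge0 ?exprn_ge0.
have [rN|Nr] := ltnP r N.
  by rewrite (bigD1 (Ordinal rN)) //= addrCA lerDl addr_ge0 // sumr_ge0.
apply: (@le_trans _ _ 1); last by rewrite lerDl sumr_ge0.
have /= := NP r Nr; rewrite sub0r normrN normrM normrX (ger0_norm rho0).
exact: ltW.
Qed.

(** Term by term differentiation.  The coefficients decay faster than any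
    geometric sequence, so the formal derivative converges to some G z, and the
    tangent errors of the monomials add up to at most 2 C |h|^2. *)
Lemma power_series_derive (R : realType) (F : R[i] -> R[i]) (a : nat -> R[i]) :
  power_series_expansion F a ->
  exists G : R[i] -> R[i],
    power_series_expansion G (fun r => a r.+1 *+ r.+1) /\
    forall z : R[i]^o, is_derive z 1 (F : R[i]^o -> R[i]^o) (G z).
Proof.
move=> Fa.
(* d z is the formal derivative with its zero term of index 0 kept, so that it
   is aligned with the series of F. *)
pose d z r : R[i]^o := a r * (z ^+ r.-1 *+ r).
(* In the radius 4 (1 + |z|), one factor 2^r absorbs the factor r brought by
   differentiation and the other leaves a convergent geometric series. *)
have bnd (z : R[i]) :
    exists C, forall r, `|a r| * (1 + `|z|) ^+ r * 2 ^+ r <= C * 2^-1 ^+ r.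
  have [|C CP] := @power_series_coef_bound _ _ _ (4 * (1 + `|z|)) Fa.
    by rewrite mulr_ge0 ?addr_ge0.
  exists C => r; have := CP r; have -> : 4 = 2 * 2 :> R[i] by rewrite -natrM.
  rewrite exprVn ler_pdivlMr ?exprn_gt0 // => /(le_trans _); apply.
  by rewrite !exprMn le_eqVlt; apply/orP; left; apply/eqP; ring.
have dz (z : R[i]) : exists l : R[i]^o, series (d z) @ \oo --> l.
  have [C CP] := bnd z; apply: (@cvg_series_geometric_dominated _ _ C) => r.
  apply: le_trans (CP r); rewrite /d normrM -mulrA ler_wpM2l // normrMn normrX.
  rewrite -[_ *+ r]mulr_natr ler_pM ?exprn_ge0 ?ler0n //.
    case: r => [|r]; first by rewrite expr0.
    rewrite succnK (@le_trans _ _ ((1 + `|z|) ^+ r)) //.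
      by rewrite lerXn2r ?nnegrE ?addr_ge0 // lerDr.
    by rewrite exprSr ler_peMr ?exprn_ge0 ?addr_ge0 // lerDl.
  by rewrite -natrX ler_nat ltnW // ltn_expl.
pose G z := projT1 (cid (dz z)).
have GP z : series (d z) @ \oo --> (G z : R[i]^o) by rewrite /G; case: cid.
exists G; split=> z.
  have -> : series (fun r : nat => a r.+1 *+ r.+1 * z ^+ r : R[i]^o) =
      [sequence series (d z) n.+1]_n; last by rewrite cvg_shiftS; exact: GP.
  apply/funext => n; rewrite !seriesEord /= big_ord_recl /d mulr0n mulr0 add0r.
  by apply: eq_bigr => r _ /=; rewrite mulrnAr mulrnAl.
have [C CP] := bnd z.
have C0 : 0 <= C by have := CP 0%N; rewrite !expr0 !mulr1; apply: le_trans.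
have quad (h : R[i]) :
    `|h| <= 1 -> `|F (z + h) - F z - G z * h| <= `|h| ^+ 2 * (C * 2).
  move=> h1; apply: (@cvg_norm_le _
    (fun n => series (fun r => a r * (z + h) ^+ r : R[i]^o) n
     - series (fun r => a r * z ^+ r : R[i]^o) n - series (d z) n * h)) => [|n].
    apply: cvgB; first by apply: cvgB; exact: Fa.
    by apply: cvgMl; exact: GP.
  rewrite !seriesEord /= mulr_suml -!sumrB.
  apply: le_trans (_ : \sum_(r < n) `|h| ^+ 2 * (C * 2^-1 ^+ r) <= _).
    apply: le_trans (ler_norm_sum _ _ _) _; apply: ler_sum => r _.
    have -> : a r * (z + h) ^+ r - a r * z ^+ r - d z r * h =
      a r * ((z + h) ^+ r - z ^+ r - (z ^+ r.-1 *+ r) * h) by rewrite /d; ring.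
    rewrite normrM.
    rewrite (le_trans (ler_wpM2l _ (ler_norm_exprD_tangent _ _ h1))) //.
    rewrite mulrCA ler_wpM2l ?exprn_ge0 // (le_trans _ (CP r)) //.
    rewrite ler_peMr ?mulr_ge0 ?exprn_ge0 ?addr_ge0 //.
    by rewrite exprn_ege1 // ler1n.
  rewrite -mulr_sumr ler_wpM2l ?exprn_ge0 // -mulr_sumr ler_wpM2l //.
  suff -> : \sum_(i < n) 2^-1 ^+ i = 2 - 2 * 2^-1 ^+ n :> R[i].
    by rewrite gerBl mulr_ge0 ?exprn_ge0 // invr_ge0.
  elim: n => [|n IH]; first by rewrite big_ord0 expr0 mulr1 subrr.
  by rewrite big_ord_recr /= IH exprS; field.
have dF : (fun h : R[i]^o => h^-1 *:
    ((F : R[i]^o -> R[i]^o) (h *: (1 : R[i]^o) + z) - F z)) @ 0^' -->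
    (G z : R[i]^o).
  apply/cvgrPdist_lt => e e0.
  have K0 : 0 < C * 2 + 1 by rewrite ltr_wpDl // mulr_ge0.
  near=> h; have h0 : h != 0 by near: h; exact: nbhs_dnbhs_neq.
  have h1 : `|h| <= 1 by near: h; exact: dnbhs0_le.
  have he : `|h| < e / (C * 2 + 1).
    by near: h; apply: dnbhs0_lt; rewrite divr_gt0.
  rewrite -normrN opprB.
  have -> : h^-1 *: (F (h *: (1 : R[i]^o) + z) - F z) - G z =
      h^-1 * (F (z + h) - F z - G z * h).
    by rewrite /GRing.scale /= mulr1 addrC [h + z]addrC; field.
  rewrite normrM normfV mulrC ltr_pdivrMr ?normr_gt0 //.
  apply: le_lt_trans (quad _ h1) _.
  rewrite expr2 -mulrA mulrC ltr_pM2r ?normr_gt0 //.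
  move: he; rewrite ltr_pdivlMr //; apply: le_lt_trans.
  by rewrite ler_wpM2l // lerDl.
apply: DeriveDef; first by apply: cvgP; exact: dF.
exact: cvg_lim dF.
Unshelve. all: by end_near. Qed.

Lemma cvg_derivn_partial_sums (R : realType) (F : R[i] -> R[i])
    (a : nat -> R[i]) (n : nat) (z : R[i]) :
  power_series_expansion F a ->
  (fun N => (\poly_(r < N) a r)^`(n).[z] : R[i]^o) @ \oo -->
    (nth_derivative n F z : R[i]^o).
Proof.
elim: n F a => [|n IH] F a Fa.
  rewrite /nth_derivative derive1n0.
  have -> : (fun N => (\poly_(r < N) a r)^`(0).[z] : R[i]^o) =
      series (fun r => a r * z ^+ r : R[i]^o); last exact: Fa.
  by apply/funext => N; rewrite seriesEord /= horner_poly.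
have [G [Gb dF]] := power_series_derive Fa.
have -> : nth_derivative n.+1 F z = nth_derivative n G z.
  rewrite /nth_derivative derive1Sn.
  have -> // : derive1 (F : R[i]^o -> R[i]^o) = G.
  by apply/funext => w; rewrite derive1E; have := dF w => ?; rewrite derive_val.
rewrite -cvg_shiftS.
have -> : [sequence (\poly_(r < N.+1) a r)^`(n.+1).[z] : R[i]^o]_N =
    (fun N => (\poly_(r < N) (a r.+1 *+ r.+1))^`(n).[z] : R[i]^o).
  apply/funext => N.
  rewrite -[LHS]/((\poly_(r < N.+1) a r)^`(n.+1).[z]) derivSn.
  have -> // : (\poly_(r < N.+1) a r)^`() = \poly_(r < N) (a r.+1 *+ r.+1).
  apply/polyP => r; rewrite coef_deriv !coef_poly ltnS.
  by case: ifP => _; rewrite ?mul0rn.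
exact: IH.
Qed.

(** * Power series in an operator *)

(** The coordinates of the algebra generated by A in which convergence is
    tested: they are bijective when d is the degree of the minimal
    polynomial. *)
Definition poly_op_row (R : realType) (V : lmodType R[i]) (A : V -> V) (d : nat)
    (c : 'rV[R[i]^o]_d) : V -> V :=
  poly_op (rVpoly (c : 'rV[R[i]]_d)) A.

Lemma poly_op_row_is_linear (R : realType) (V : lmodType R[i]) (A : V -> V)
    (d : nat) :
  linear (@poly_op_row R V A d).
Proof.
move=> k u v; apply/funext => w; rewrite /poly_op_row.
by rewrite linearP poly_op_linearl.
Qed.

HB.instance Definition _ (R : realType) (V : lmodType R[i]) (A : V -> V)
    (d : nat) :=
  GRing.isLinear.Build R[i]^o 'rV[R[i]^o]_d (V -> V) _ (@poly_op_row R V A d)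
    (@poly_op_row_is_linear R V A d).

(** The row of coefficients of the remainder modulo M of a partial sum S_N is a
    linear combination, with coefficients independent of N, of the values of
    finitely many derivatives of S_N at the roots of T. *)
Lemma op_power_series_sum_interpolation (R : realType) (V : lmodType R[i])
    (A : {linear V -> V}) (T : {poly R[i]}) (k : nat) (lam : 'I_k -> R[i])
    (m : 'I_k -> nat) (F : R[i] -> R[i]) (a : nat -> R[i]) (L : {poly R[i]}) :
  (forall v, poly_op T A v = 0) -> roots_with_multiplicities T lam m ->
  power_series_expansion F a -> is_lagrange_interpolation lam m F L ->
  op_power_series_sum a A (poly_op L A).
Proof.
move=> TA rT Fa [_ LF]; have [T0 _ _ _] := rT.
have [M [M0 MA Mmin]] := minimal_polynomial T0 TA.
have [H HP] := hermite_basis rT.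
pose d := (size M).-1.
have sM : size M = d.+1 by rewrite /d prednK // size_poly_gt0.
pose row (p : {poly R[i]}) : 'rV[R[i]^o]_d := poly_rV (p %% M).
have rowK p : poly_op_row A (row p) = poly_op p A.
  apply/funext => v; rewrite /poly_op_row /row poly_rV_K; last first.
    by rewrite -ltnS -sM ltn_modp.
  apply: (poly_op_congr MA).
  by rewrite {2}(divp_eq p M) opprD addrCA subrr addr0 dvdpNr dvdp_mull.
have row0 : row 0 = 0 by rewrite /row mod0p linear0.
have rowD : {morph row : p q / p + q} by move=> p q; rewrite /row modpD linearD.
have rowZ c p : row (c *: p) = c *: row p by rewrite /row modpZl linearZ.
have rowE p :
    row p = \sum_(j < k) \sum_(n < m j) p^`(n).[lam j] *: row (H j n).
  have MT : M %| T by exact: Mmin.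
  have /(dvdp_trans MT)/modp_eq0P pE := HP p.
  rewrite -{1}[p](subrK
    (\sum_(j < k) \sum_(n < m j) p^`(n).[lam j] *: H j n)).
  rewrite rowD {1}/row pE linear0 add0r (big_morph row rowD row0).
  apply: eq_bigr => j _; rewrite (big_morph row rowD row0).
  by apply: eq_bigr => n _; rewrite rowZ.
exists d, (@poly_op_row R V A d); split.
- move=> u v uv; apply/eqP; rewrite -subr_eq0.
  rewrite -[_ == 0](inj_eq (can_inj (@rVpolyK _ _))) linear0.
  have /Mmin : forall w, poly_op (rVpoly (u - v : 'rV[R[i]]_d)) A w = 0.
    move=> w; have := congr1 (fun f => f w) uv; rewrite /= /poly_op_row => E.
    by rewrite linearB /= -scaleN1r addrC poly_op_linearl E scaleN1r addNr.
  apply: contraTT => /dvdp_leq le; apply/negP => /le.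
  by rewrite leqNgt sM ltnS size_poly.
- apply/seteqP; split=> [_ [c _ <-]|_ [p _ <-]]; first by exists (rVpoly c).
  by exists (row p) => //; exact: rowK.
exists (fun N => row (\poly_(r < N) a r)), (row L); split=> [N||].
- rewrite /= rowK; apply/funext => v.
  rewrite (@poly_op_widen _ _ _ _ N) ?size_poly //.
  by apply: eq_bigr => r _; rewrite coef_poly ltn_ord.
- exact: rowK.
rewrite [row L]rowE.
have -> : (fun N => row (\poly_(r < N) a r)) =
    (fun N => \sum_(j < k) \sum_(n < m j)
      (\poly_(r < N) a r)^`(n).[lam j] *: row (H j n)).
  by apply/funext => N; exact: rowE.
apply: cvg_big => [|j _]; first exact: add_continuous.
apply: cvg_big => [|n _]; first exact: add_continuous.
apply: cvgZr_tmp; rewrite LF //; exact: cvg_derivn_partial_sums.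
Qed.

Local Close Scope classical_set_scope.
Unset Implicit Arguments.

Theorem theorem2p4 (R : realType) (V : lmodType R[i]) (A : {linear V -> V})
    (T : {poly R[i]}) (hT : T != 0) (hTA : forall v : V, poly_op T A v = 0)
    (k : nat) (lam : 'I_k -> R[i]) (m : 'I_k -> nat)
    (hlam_inj : injective lam)
    (hlam : forall z : R[i], root T z <-> exists j : 'I_k, lam j = z)
    (hm : forall j : 'I_k, m j = mup (lam j) T) :
  [/\ (forall j : 'I_k, lam j != 0) ->
      exists A' : {linear V -> V},
        op_inverse A A' /\
        forall L : {poly R[i]},
          is_lagrange_interpolation lam m (fun x => x^-1) L ->
          A' =1 poly_op L A,
      forall P Q : {poly R[i]},
        (forall j : 'I_k, Q.[lam j] != 0) ->
        exists QA' : {linear V -> V},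
          op_inverse (poly_op Q A) QA' /\
          forall L : {poly R[i]},
            is_lagrange_interpolation lam m (fun x => P.[x] / Q.[x]) L ->
            poly_op P A \o QA' =1 poly_op L A
    & forall (F : R[i] -> R[i]) (a : nat -> R[i]),
        entire F -> power_series_expansion F a ->
        forall L : {poly R[i]},
          is_lagrange_interpolation lam m F L ->
          op_power_series_sum a A (poly_op L A)].
Proof.
have rT : roots_with_multiplicities T lam m by [].
split=> [lam0|P Q|F a _].
- have [j|A' [[A'K KA'] LA']] :=
    @rational_functional_calculus _ _ _ _ _ _ _ 1 'X hTA rT.
    by rewrite hornerX.
  have AX v : poly_op 'X A v = A v.
    by rewrite -['X]mul1r poly_opMX poly_opC scale1r.
  exists A'; split=> [|L LL v]; first by split=> v; rewrite -AX.
  rewrite -(LA' L) /= ?poly_opC ?scale1r //.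
  have -> // : (fun x => 1.[x] / 'X.[x]) = (fun x : R[i] => x^-1).
  by apply/funext => x; rewrite hornerC hornerX mul1r.
- exact: rational_functional_calculus hTA rT.
- by move=> Fa L LF; exact: op_power_series_sum_interpolation hTA rT Fa LF.
Qed.
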